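(* Let $X$ and $X'$ be integrable random convex bodies in $\mathbb{R}^d$. Then their lift expectations coincide, $\hat{Z}_X=\hat{Z}_{X'}$, if and only if for every $u\in\mathbb{R}^d$ such that at least one of the random variables $h_X(u)$, $h_{X'}(u)$ is integrable, the distributions of $h_X(u)$ and $h_{X'}(u)$ coincide.
   Context: A random convex closed set $X$ in $\mathbb{R}^d$ is a map from a probability space $(\Omega,\mathfrak{F},\mathbf{P})$ to the family of convex closed subsets of $\mathbb{R}^d$ such that $\{\omega: X(\omega)\cap K\neq\emptyset\}\in\mathfrak{F}$ for all compact $K\subset\mathbb{R}^d$. If $X$ is almost surely compact and non-empty, it is called a random convex body. The support function of $X$ is $h_X(u)=\sup\{\langle x,u\rangle: x\in X\}$, $u\in\mathbb{R}^d$. A random convex closed set $X$ is integrable if there exists an integrable random vector $\xi$ (called an integrable selection of $X$) with $\xi\in X$ a.s. The selection expectation $\mathbf{E}X$ is the closure of the set of expectations $\mathbf{E}\xi$ of all integrable selections $\xi$ of $X$ (it may be unbounded). The lift expectation of a random convex body $X$ in $\mathbb{R}^d$ is the set $\hat{Z}_X=\mathbf{E}Y\subset\mathbb{R}^{d+1}$, the selection expectation of the random convex body $Y=\mathrm{conv}\big(\{(0,\boldsymbol{0})\}\cup(\{1\}\times X)\big)$ in $\mathbb{R}^{d+1}$, i.e. the convex hull of the origin $(0,\boldsymbol{0})$ of $\mathbb{R}^{d+1}=\mathbb{R}\times\mathbb{R}^d$ and the set $\{1\}\times X$ ($Y$ is always integrable, since it contains the origin). *)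

(* Defs.v *)
From HB Require Import structures.
From mathcomp Require Import all_boot all_order all_algebra.
From mathcomp Require Import all_classical all_reals all_analysis.
(* the Borel sigma-algebra of \bar R is not re-exported by all_analysis *)
From mathcomp Require Import measurable_realfun.

Set Implicit Arguments.
Unset Strict Implicit.
Unset Printing Implicit Defensive.

Import Order.TTheory GRing.Theory Num.Theory.
Import numFieldNormedType.Exports.

Local Open Scope classical_set_scope.
Local Open Scope ring_scope.

Definition inner {R : realType} {n : nat} (x u : 'rV[R]_n) : R :=
  \sum_(i < n) x 0 i * u 0 i.

(* Extended real-valued: it is -oo on the empty set and may be +oo on an
   unbounded one; for a random convex body both happen with probability 0. *)
Definition support_function {R : realType} {n : nat} (A : set 'rV[R]_n)
    (u : 'rV[R]_n) : \bar R :=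
  ereal_sup [set (inner x u)%:E | x in A].

Definition convex_hull {R : realType} {n : nat} (A : set 'rV[R]_n) :
    set 'rV[R]_n :=
  smallest (@convex_set R 'rV[R]_n) A.

Definition random_convex_closed_set {R : realType} {disp : measure_display}
    {T : measurableType disp} {n : nat} (X : T -> set 'rV[R]_n) : Prop :=
  [/\ forall w, closed (X w),
      forall w, @convex_set R 'rV[R]_n (X w) &
      forall K : set 'rV[R]_n, compact K ->
        measurable [set w | X w `&` K !=set0]].

Definition random_convex_body {R : realType} {disp : measure_display}
    {T : measurableType disp} (P : probability T R) {n : nat}
    (X : T -> set 'rV[R]_n) : Prop :=
  random_convex_closed_set X /\
  {ae P, forall w, compact (X w) /\ X w !=set0}.

(* The Borel sigma-algebra of R^n is generated by the coordinates, and the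
   Euclidean norm is integrable iff every coordinate is, so measurability and
   integrability of a random vector are stated coordinatewise ([integrable]
   includes measurability). *)
Definition integrable_vector {R : realType} {disp : measure_display}
    {T : measurableType disp} (P : probability T R) {n : nat}
    (xi : T -> 'rV[R]_n) : Prop :=
  forall i : 'I_n, P.-integrable setT (fun w => (xi w 0 i)%:E).

Definition vector_expectation {R : realType} {disp : measure_display}
    {T : measurableType disp} (P : probability T R) {n : nat}
    (xi : T -> 'rV[R]_n) : 'rV[R]_n :=
  \row_(i < n) fine 'E_P[fun w => xi w 0 i].

Definition integrable_selection {R : realType} {disp : measure_display}
    {T : measurableType disp} (P : probability T R) {n : nat}
    (X : T -> set 'rV[R]_n) (xi : T -> 'rV[R]_n) : Prop :=
  integrable_vector P xi /\ {ae P, forall w, X w (xi w)}.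

Definition integrable_random_set {R : realType} {disp : measure_display}
    {T : measurableType disp} (P : probability T R) {n : nat}
    (X : T -> set 'rV[R]_n) : Prop :=
  exists xi, integrable_selection P X xi.

Definition selection_expectation {R : realType} {disp : measure_display}
    {T : measurableType disp} (P : probability T R) {n : nat}
    (X : T -> set 'rV[R]_n) : set 'rV[R]_n :=
  closure [set vector_expectation P xi | xi in integrable_selection P X].

(* R x R^n is 'rV_(1 + n), the point (1, x) being row_mx (const_mx 1) x. *)
Definition lift_set {R : realType} {n : nat} (A : set 'rV[R]_n) :
    set 'rV[R]_(1 + n) :=
  convex_hull ([set 0] `|` [set row_mx (const_mx 1) x | x in A]).

Definition lift_expectation {R : realType} {disp : measure_display}
    {T : measurableType disp} (P : probability T R) {n : nat}
    (X : T -> set 'rV[R]_n) : set 'rV[R]_(1 + n) :=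
  selection_expectation P (fun w => lift_set (X w)).

(* The two random variables may live on different probability spaces. *)
Definition same_distribution {R : realType} {disp disp' : measure_display}
    {T : measurableType disp} {T' : measurableType disp'}
    (P : probability T R) (P' : probability T' R)
    (f : T -> \bar R) (g : T' -> \bar R) : Prop :=
  forall B : set (\bar R), measurable B ->
    pushforward P f B = pushforward P' g B.

(* Main.v *)
Require Import Defs.
From HB Require Import structures.
From mathcomp Require Import all_boot all_order all_algebra.
From mathcomp Require Import all_classical all_reals all_analysis.
From mathcomp Require Import measurable_realfun lra ring.
Import Order.TTheory GRing.Theory Num.Theory.
Import numFieldNormedType.Exports.
Local Open Scope classical_set_scope.
Local Open Scope ring_scope.
Set Implicit Arguments.
Unset Strict Implicit.
Unset Printing Implicit Defensive.

(** For a fixed direction [(t, u)] of the lifted space, the support function of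
    [conv ({0} `|` ({1} x X))] at [(t, u)] is the positive part of
    [t + h_X(u)], and taking a selection expectation commutes with taking
    support functions.  Hence the support function of the lift expectation at
    [(t, u)] is the mean of that positive part
    ([support_function_lift_expectation]), which, as a function of [t], is the
    stop-loss transform of the random variable [h_X(u)].  A closed convex set
    is determined by its support function ([mem_closed_convex]), so two lift
    expectations coincide exactly when, for every [u], the stop-loss transforms
    of [h_X(u)] and [h_X'(u)] coincide.

    A finite stop-loss transform determines the distribution, because its
    difference quotients are squeezed between tail probabilities
    ([stop_loss_same_distribution]).  An integrable selection of [X] bounds the
    negative part of [h_X(u)], so the stop-loss transform is finite exactly when
    [h_X(u)] is integrable ([integrable_support_function]) and is identically
    infinite otherwise.  If both support functions are non-integrable in
    direction [u], the two transforms are therefore equal for free, and these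
    are exactly the directions that the criterion leaves out.

    The step that needs real work is the exchange of support function and
    expectation.  One inequality is the monotonicity of the integral.  The
    other one needs a measurable selection of [X] that maximizes the scalar
    product with [u]; it is the lexicographically largest point of the face of
    [X] in direction [u] ([measurable_maximizer]).  Truncating it to the events
    where it is bounded and lifting it gives integrable selections of the
    lifted body whose means exhaust the stop-loss transform by monotone
    convergence ([selection_inner_approx]). *)

(** * Scalar products, support functions and separation *)

Section inner_product.
Context {R : realType} {n : nat}.
Implicit Types x y u v : 'rV[R]_n.

Lemma innerC x u : inner x u = inner u x.
Proof. by apply: eq_bigr => i _; rewrite mulrC. Qed.

Lemma innerDl x y u : inner (x + y) u = inner x u + inner y u.
Proof. by rewrite -big_split; apply: eq_bigr => i _; rewrite mxE mulrDl. Qed.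

Lemma innerZl a x u : inner (a *: x) u = a * inner x u.
Proof. by rewrite /inner mulr_sumr; apply: eq_bigr => i _; rewrite mxE mulrA. Qed.

Lemma innerBl x y u : inner (x - y) u = inner x u - inner y u.
Proof. by rewrite innerDl -scaleN1r innerZl mulN1r. Qed.

Lemma inner_sqrB t x y :
  inner (x - t *: y) (x - t *: y) =
  inner x x - 2 * t * inner y x + t ^+ 2 * inner y y.
Proof.
rewrite innerBl innerZl (innerC x) (innerC y) !innerBl !innerZl (innerC x y).
by ring.
Qed.

Lemma inner0l u : inner 0 u = 0.
Proof. by rewrite -(scale0r 0) innerZl mul0r. Qed.

Lemma inner_delta x i : inner x (delta_mx 0 i) = x 0 i.
Proof.
rewrite /inner (bigD1 i)//= big1 ?addr0 => [|j /negPf ji]; rewrite mxE eqxx ?ji.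
  by rewrite eqxx mulr1.
by rewrite mulr0.
Qed.

Lemma inner_self_ge0 x : 0 <= inner x x.
Proof. by apply: sumr_ge0 => i _; rewrite -expr2 sqr_ge0. Qed.

(** Compares the max norm of row vectors, which carries the topology, with the
    Euclidean one. *)
Lemma sqr_norm_le_inner x : `|x| ^+ 2 <= inner x x.
Proof.
rewrite {1}/Num.norm/=; have [->|/mx_norm_neq0[[i j] ->]] := eqVneq (mx_norm x) 0.
  by rewrite expr0n inner_self_ge0.
rewrite real_normK ?num_real//= /inner (bigD1 j)//= (ord1 i) expr2 lerDl.
by apply: sumr_ge0 => k _; rewrite -expr2 sqr_ge0.
Qed.

Lemma inner_self_eq0 x : inner x x <= 0 -> x = 0.
Proof.
move=> /(le_trans (sqr_norm_le_inner x)) x0; apply/eqP.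
by rewrite -normr_eq0 -sqrf_eq0 eq_le x0 sqr_ge0.
Qed.

Lemma inner_continuous u : continuous (inner ^~ u).
Proof.
apply: continuous_big => [|i _ x]; first exact: add_continuous.
by apply: continuousM; [exact: coord_continuous|exact: cst_continuous].
Qed.

End inner_product.

Lemma compact_max_inner {R : realType} {n : nat} (A : set 'rV[R]_n) u :
  compact A -> A !=set0 ->
  exists2 x, A x & forall y, A y -> inner y u <= inner x u.
Proof.
move=> cA A0.
have [|x xA xmax] := compact_EVT_max (f := inner ^~ u) A0 cA.
  exact/continuous_subspaceT/inner_continuous.
by exists x; [exact: set_mem|move=> y yA; exact/xmax/mem_set].
Qed.

Lemma support_function_max {R : realType} {n : nat} (A : set 'rV[R]_n) u x :
  A x -> (forall y, A y -> inner y u <= inner x u) ->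
  support_function A u = (inner x u)%:E.
Proof.
move=> Ax xmax; apply/eqP; rewrite eq_le; apply/andP; split.
  by apply: ge_ereal_sup => _ [y Ay <-]; rewrite lee_fin xmax.
by apply: ereal_sup_ubound; exists x.
Qed.

Lemma support_function_gtP {R : realType} {n : nat} (A : set 'rV[R]_n) u a :
  (a%:E < support_function A u)%E <-> exists2 x, A x & a < inner x u.
Proof.
split=> [/ereal_sup_gt[_ [x Ax <-]]|[x Ax ax]]; first by rewrite lte_fin; exists x.
apply: (@lt_le_trans _ _ (inner x u)%:E); first by rewrite lte_fin.
by apply: ereal_sup_ubound; exists x.
Qed.

Lemma convex_setP {R : realType} {n : nat} (A : set 'rV[R]_n) :
  @convex_set R 'rV[R]_n A <->
  forall x y t, A x -> A y -> 0 <= t <= 1 -> A (t *: x + (1 - t) *: y).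
Proof.
split=> [cA x y t Ax Ay /andP[t0 t1]|cA x y t /set_mem Ax /set_mem Ay].
  by have /set_mem := cA x y (Itv01 t0 t1) (mem_set Ax) (mem_set Ay).
by apply: mem_set; apply: cA => //; rewrite ge0 le1.
Qed.

(** Otherwise the difference between [x] and its nearest point [y] in [A] would
    be a direction in which [x] lies strictly beyond [A]. *)
Lemma mem_closed_convex {R : realType} {n : nat} (A : set 'rV[R]_n) x :
  closed A -> @convex_set R 'rV[R]_n A -> A !=set0 ->
  (forall v, ((inner x v)%:E <= support_function A v)%E) -> A x.
Proof.
move=> clA /convex_setP cA [a Aa] xA.
pose f y : R := inner (x - y) (x - y).
have cf : continuous f.
  have -> : f = fun y => \sum_i (x 0 i - y 0 i) * (x 0 i - y 0 i).
    by apply/funext => y; apply: eq_bigr => i _; rewrite !mxE.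
  apply: continuous_big => [|i _ y]; first exact: add_continuous.
  have cxy : {for y, continuous (fun y : 'rV[R]_n => x 0 i - y 0 i)}.
    by apply: continuousB; [exact: cst_continuous|exact: coord_continuous].
  exact: (continuousM cxy cxy).
(* The nearest point is sought in a bounded part of [A], which is compact. *)
pose B := A `&` [set y | f y <= f a].
have Ba : B !=set0 by exists a; split => //=.
have cB : compact B.
  apply: bounded_closed_compact.
    exists (`|x| + (f a + 1)); split=> [|M MB y [_ /= fya]]; first exact: num_real.
    apply: le_trans (ltW MB).
    have -> : y = x - (x - y) by rewrite subKr.
    apply: (le_trans (ler_normB _ _)); rewrite lerD2l.
    have := le_trans (sqr_norm_le_inner (x - y)) fya.
    by have := normr_ge0 (x - y); nra.
  apply: closedI => //; rewrite (_ : mkset _ = f @^-1` [set z | z <= f a])//.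
  by apply: preimage_closed => [z _|]; [exact: cf|exact: closed_le].
have [|y /set_mem[Ay _] ymin] := compact_EVT_min (f := f) Ba cB.
  exact: continuous_subspaceT.
have {}ymin z : A z -> f y <= f z.
  move=> Az; have [fza|/ltW fza] := leP (f z) (f a).
    by apply/ymin/mem_set; split.
  by apply: le_trans fza; apply/ymin/mem_set; split => //=.
have yproj z : A z -> inner (z - y) (x - y) <= 0.
  move=> Az; rewrite leNgt; apply/negP => zy.
  have key t : 0 < t <= 1 -> 2 * inner (z - y) (x - y) <= t * inner (z - y) (z - y).
    move=> /andP[t0 t1].
    have := ymin _ (cA _ _ t Az Ay _); rewrite (ltW t0) t1 => /(_ isT).
    have -> : f (t *: z + (1 - t) *: y) =
        f y - 2 * t * inner (z - y) (x - y) + t ^+ 2 * inner (z - y) (z - y).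
      rewrite /f (_ : x - _ = (x - y) - t *: (z - y)); last first.
        by apply/rowP => i; rewrite !mxE; ring.
      by rewrite inner_sqrB.
    by move=> h; rewrite -(ler_pM2l t0); lra.
  have z0 := inner_self_ge0 (z - y).
  set p := inner (z - y) (x - y) in zy key.
  set q := inner (z - y) (z - y) in z0 key.
  (* Any small [t] would do; this one is positive and at most 1 even if [q = 0]. *)
  have := key (p / (p + q)).
  have pq : 0 < p + q by lra.
  rewrite divr_gt0//= ler_pdivrMr// mul1r lerDl z0 => /(_ isT).
  by rewrite mulrAC ler_pdivlMr//; nra.
suff /inner_self_eq0/eqP : inner (x - y) (x - y) <= 0.
  by rewrite subr_eq0 => /eqP ->.
rewrite innerBl subr_le0 -lee_fin (le_trans (xA _))//.
apply: ge_ereal_sup => _ [z /yproj zy <-].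
by move: zy; rewrite innerBl subr_le0 lee_fin.
Qed.

(** * Measurability of support functions and measurable maximizers *)

Definition hitting_measurable {R : realType} {disp : measure_display}
    {T : measurableType disp} {n : nat} (X : T -> set 'rV[R]_n) : Prop :=
  forall K, compact K -> measurable [set w | X w `&` K !=set0].

Section random_sets.
Context {R : realType} {disp : measure_display} {T : measurableType disp}
  {n : nat}.
Implicit Types X : T -> set 'rV[R]_n.

Lemma bigcup_hit X (F : nat -> set 'rV[R]_n) :
  [set w | X w `&` (\bigcup_k F k) !=set0] =
  \bigcup_k [set w | X w `&` F k !=set0].
Proof.
apply/seteqP; split=> [w [x [Xx [k _ Fx]]]|w [k _ [x [Xx Fx]]]].
  by exists k => //; exists x.
by exists x; split=> //; exists k.
Qed.

(** A closed set is the countable union of its bounded parts, which are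
    compact. *)
Lemma measurable_hit_closed X F : hitting_measurable X -> closed F ->
  measurable [set w | X w `&` F !=set0].
Proof.
move=> mX clF.
have -> : F = \bigcup_k (F `&` [set x | `|x| <= k%:R]).
  apply/seteqP; split=> [x Fx|x [k _ []]//].
  exists (Num.truncn `|x|).+1 => //; split=> //=.
  by apply/ltW/Num.Theory.truncnS_gt.
rewrite bigcup_hit; apply: bigcup_measurable => k _; apply: mX.
apply: bounded_closed_compact.
  exists k%:R; split=> [|M kM x [_ /= xk]]; first exact: num_real.
  exact: le_trans (ltW kM).
apply: closedI => //; rewrite (_ : mkset _ = Num.norm @^-1` [set z | z <= k%:R])//.
by apply: preimage_closed => [z _|]; [exact: norm_continuous|exact: closed_le].
Qed.

Lemma measurable_hit_halfspace X u a : hitting_measurable X ->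
  measurable [set w | X w `&` [set x | a < inner x u] !=set0].
Proof.
move=> mX.
have -> : [set x | a < inner x u] =
    \bigcup_k [set x | a + k.+1%:R^-1 <= inner x u].
  apply/seteqP; split=> [x /= ax|x [k _ /=]]; last first.
    by apply: lt_le_trans; rewrite ltrDl invr_gt0 ltr0n.
  have e0 : 0 < inner x u - a by rewrite subr_gt0.
  exists (Num.truncn (inner x u - a)^-1) => //=.
  rewrite addrC -lerBrDr -[leRHS]invrK lef_pV2 ?posrE ?invr_gt0//.
  by apply/ltW/Num.Theory.truncnS_gt.
rewrite bigcup_hit; apply: bigcup_measurable => k _.
apply: measurable_hit_closed => //.
rewrite (_ : mkset _ = (inner ^~ u) @^-1` [set z | a + k.+1%:R^-1 <= z])//.
by apply: preimage_closed => [z _|]; [exact: inner_continuous|exact: closed_ge].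
Qed.

(** The support function exceeds [a] exactly when the set meets the open half
    space beyond [a]. *)
Lemma measurable_support_function X u : hitting_measurable X ->
  measurable_fun setT (fun w => support_function (X w) u).
Proof.
move=> mX mT.
apply: (measurability _ (ErealGenOInfty.measurableE R)) => //.
move=> _ [_ [a ->] <-]; rewrite setTI.
rewrite (_ : _ @^-1` _ = [set w | X w `&` [set x | a < inner x u] !=set0]).
  exact: measurable_hit_halfspace.
apply/seteqP; split=> w /=; rewrite in_itv/= andbT support_function_gtP.
  by case=> x Xx ax; exists x.
by case=> x [Xx ax]; exists x.
Qed.

End random_sets.

Definition face {R : realType} {n : nat} (A : set 'rV[R]_n) (u : 'rV[R]_n) :=
  A `&` [set x | forall y, A y -> inner y u <= inner x u].

Section faces.
Context {R : realType} {n : nat}.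
Implicit Types (A : set 'rV[R]_n) (u : 'rV[R]_n).

Lemma compact_face A u : compact A -> compact (face A u).
Proof.
move=> cA; apply: compact_closedI => //.
rewrite (_ : mkset _ =
    \bigcap_(y in A) [set x : 'rV[R]_n | inner y u <= inner x u]).
  apply: closed_bigI => y _.
  rewrite (_ : mkset _ = (inner ^~ u) @^-1` [set z | inner y u <= z])//.
  by apply: preimage_closed => [z _|]; [exact: inner_continuous|exact: closed_ge].
by apply/seteqP; split.
Qed.

Lemma face_nonempty A u : compact A -> A !=set0 -> face A u !=set0.
Proof. by move=> cA A0; have [x Ax xmax] := compact_max_inner u cA A0; exists x. Qed.

(** Turns a hitting event of a face into a comparison of two support functions,
    each of which is measurable when [A] is random. *)
Lemma face_hitE A u K : compact A -> compact K ->
  (face A u `&` K !=set0) <->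
  ((A `&` K) !=set0 /\ (support_function A u <= support_function (A `&` K) u)%E).
Proof.
move=> cA cK; split=> [[x [[Ax xmax] Kx]]|[AK0 AK]].
  split; first by exists x.
  rewrite (support_function_max Ax)//.
  by apply: ereal_sup_ubound; exists x.
have [|x [Ax Kx] xmax] := compact_max_inner (A := A `&` K) u _ AK0.
  by apply: compact_closedI => //; apply: compact_closed cK; exact: norm_hausdorff.
exists x; split=> //; split=> // y Ay; rewrite -lee_fin.
rewrite (support_function_max (A := A `&` K) _ xmax) // in AK.
by apply: le_trans AK; apply: ereal_sup_ubound; exists y.
Qed.

Lemma hitting_measurable_face {disp : measure_display} {T : measurableType disp}
    (X : T -> set 'rV[R]_n) u :
  hitting_measurable X -> (forall w, compact (X w)) ->
  hitting_measurable (fun w => face (X w) u).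
Proof.
move=> mX cX K cK.
rewrite (_ : mkset _ = [set w | X w `&` K !=set0] `&` ([set: T] `&`
    [set w | (support_function (X w) u <= support_function (X w `&` K) u)%E])).
  apply: measurableI; first exact: mX.
  apply: measurable_lee => //; apply: measurable_support_function => // L cL.
  rewrite (_ : mkset _ = [set w | X w `&` (K `&` L) !=set0]).
    by apply: mX; apply: compact_closedI => //; apply: compact_closed cL;
      exact: norm_hausdorff.
  by apply/seteqP; split=> w /=; rewrite setIA.
by rewrite setTI; apply/seteqP; split=> w /=; rewrite face_hitE.
Qed.

Definition iterated_face A (us : seq 'rV[R]_n) := foldl face A us.

Lemma iterated_face_sub us A : iterated_face A us `<=` A.
Proof. by elim: us A => [|v us IH] A x // /(IH (face A v))[]. Qed.

Lemma iterated_face_nonempty us A :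
  compact A -> A !=set0 -> iterated_face A us !=set0.
Proof.
elim: us A => [|v us IH] A cA A0 //.
by apply: (IH (face A v)); [exact: compact_face|exact: face_nonempty].
Qed.

Lemma iterated_face_eq us A x y : iterated_face A us x -> iterated_face A us y ->
  forall u, u \in us -> inner x u = inner y u.
Proof.
elim: us A => [|v us IH] A xA yA u //; rewrite inE => /predU1P[->|].
  have [Ax xmax] := iterated_face_sub (A := face A v) xA.
  have [Ay ymax] := iterated_face_sub (A := face A v) yA.
  by apply/eqP; rewrite eq_le xmax// ymax.
exact: (IH (face A v)).
Qed.

Lemma hitting_measurable_iterated_face {disp : measure_display}
    {T : measurableType disp} us (X : T -> set 'rV[R]_n) :
  hitting_measurable X -> (forall w, compact (X w)) ->
  hitting_measurable (fun w => iterated_face (X w) us).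
Proof.
elim: us X => [|v us IH] X mX cX //; apply: (IH (fun w => face (X w) v)).
  exact: hitting_measurable_face.
by move=> w; exact: compact_face.
Qed.

End faces.

(** Maximizing in direction [u] and then along all coordinates leaves one point,
    so that meeting a closed set means that this point belongs to it. *)
Lemma measurable_maximizer {R : realType} {disp : measure_display}
    {T : measurableType disp} {n : nat} (X : T -> set 'rV[R]_n) u :
  hitting_measurable X -> (forall w, compact (X w)) ->
  (forall w, X w !=set0) ->
  exists xi : T -> 'rV[R]_n,
    (forall i, measurable_fun setT (fun w => xi w 0 i)) /\
    forall w, X w (xi w) /\ forall y, X w y -> inner y u <= inner (xi w) u.
Proof.
move=> mX cX X0.
pose us := [seq delta_mx 0 i : 'rV[R]_n | i <- enum 'I_n].
pose F w := iterated_face (face (X w) u) us.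
have F0 w : F w !=set0.
  by apply: iterated_face_nonempty; [exact: compact_face|exact: face_nonempty].
have [xi Fxi] := choice F0.
have F1 w x : F w x -> x = xi w.
  move=> Fx; apply/rowP => i; rewrite -!inner_delta.
  apply: (iterated_face_eq Fx (Fxi w)).
  by apply: map_f; rewrite mem_enum.
exists xi; split=> [i|w]; last by have [] := iterated_face_sub (Fxi w).
move=> mT; apply: (measurability _ (RGenCInfty.measurableE R)) => //.
move=> _ [_ [a ->] <-]; rewrite setTI.
rewrite (_ : _ @^-1` _ = [set w | F w `&` [set x | a <= x 0 i] !=set0]).
  apply: measurable_hit_closed.
    apply: (@hitting_measurable_iterated_face _ _ _ _ us (fun w => face (X w) u)).
      exact: hitting_measurable_face.
    by move=> w; exact: compact_face.
  apply: (preimage_closed (f := fun x : 'rV[R]_n => x 0 i) (D := [set z | a <= z])).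
    by move=> z _; exact: coord_continuous.
  exact: closed_ge.
apply/seteqP; split=> w /=; rewrite in_itv/= andbT.
  by exists (xi w).
by case=> x [/F1 ->].
Qed.

(** Replacing the body by [{0}] on a measurable null set makes it compact and
    nonempty everywhere. *)
Lemma random_convex_body_maximizer {R : realType} {disp : measure_display}
    {T : measurableType disp} (P : probability T R) {n : nat}
    (X : T -> set 'rV[R]_n) u :
  random_convex_body P X ->
  exists xi : T -> 'rV[R]_n,
    (forall i, measurable_fun setT (fun w => xi w 0 i)) /\
    {ae P, forall w, X w (xi w) /\ support_function (X w) u = (inner (xi w) u)%:E}.
Proof.
move=> [[_ _ mX] [N [mN PN subN]]].
pose Y w := if w \in N then [set 0] else X w.
have XN w : w \notin N -> compact (X w) /\ X w !=set0.
  move=> wN; apply: contrapT => bad; move/negP: wN; apply.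
  by apply/mem_set/subN.
have [||w|xi [mxi xiY]] := @measurable_maximizer _ _ _ _ Y u.
- move=> K cK; rewrite (_ : mkset _ =
      ([set w | X w `&` K !=set0] `\` N) `|` (N `&` [set w | K 0])).
    apply: measurableU; first by apply: measurableD => //; exact: mX.
    apply: measurableI => //; have [K0|K0] := pselect (K 0).
      by rewrite (_ : mkset _ = setT)//; apply/seteqP; split.
    by rewrite (_ : mkset _ = set0)//; apply/seteqP; split.
  apply/seteqP; split=> w /=; rewrite /Y.
    case: ifPn => [/set_mem wN [_ [-> K0]]|wN XK]; first by right.
    by left; split=> //; move/mem_set; apply/negP.
  case=> [[XK wN]|[wN K0]]; first by rewrite memNset.
  by rewrite mem_set//; exists 0.
- by move=> w; rewrite /Y; case: ifPn => [_|/XN[]//]; exact: compact_set1.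
- by rewrite /Y; case: ifPn => [_|/XN[]//]; exists 0.
exists xi; split=> //; exists N; split=> // w /= bad; apply: contrapT => wN.
apply: bad; have := xiY w; rewrite /Y memNset// => -[Xw xmax].
by split=> //; exact: support_function_max.
Qed.

(** * Stop-loss transforms and distributions *)

Section distributions.
Context {R : realType} {disp disp' : measure_display}
  {T : measurableType disp} {T' : measurableType disp'}
  (P : probability T R) (P' : probability T' R).
Variables (f : T -> \bar R) (g : T' -> \bar R).
Hypotheses (mf : measurable_fun setT f) (mg : measurable_fun setT g).
Local Open Scope ereal_scope.

(** The open upper rays are stable under intersection and generate the Borel sets
    of the extended line. *)
Lemma same_distribution_tails :
  (forall a : R, P [set w | a%:E < f w] = P' [set w | a%:E < g w]) ->
  same_distribution P P' f g.
Proof.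
move=> tails.
have mfB B : measurable B -> measurable (f @^-1` B).
  by move=> mB; rewrite -[X in measurable X]setTI; exact: mf.
have mgB B : measurable B -> measurable (g @^-1` B).
  by move=> mB; rewrite -[X in measurable X]setTI; exact: mg.
have genE := ErealGenOInfty.measurableE R.
suff H : forall B, <<s @ErealGenOInfty.G R >> B ->
    pushforward P f B = pushforward P' g B.
  by move=> B; rewrite /measurable/= genE; exact: H.
apply: (dynkin_induction genE).
- move=> _ _ [a ->] [b ->]; exists (Num.max a b).
  apply/seteqP; split=> x /=; rewrite !in_itv/= !andbT EFin_max gt_max.
    by case=> -> ->.
  by move=> /andP.
- by rewrite /pushforward !preimage_setT !probability_setT.
- move=> _ [a ->]; rewrite /pushforward.
  have rayE U (h : U -> \bar R) : h @^-1` `]a%:E, +oo[ = [set w | a%:E < h w].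
    by apply/seteqP; split=> w /=; rewrite in_itv/= andbT.
  by rewrite !rayE.
- move=> B mB; rewrite /pushforward => PB; rewrite -!preimage_setC.
  have PfB := probability_setC P (mfB _ mB).
  have PgB := probability_setC P' (mgB _ mB).
  by rewrite PfB PgB; congr (_ - _).
- move=> F mF tF PF; rewrite /pushforward !preimage_bigcup.
  have tFh U (h : U -> \bar R) : trivIset setT (fun k => h @^-1` F k).
    by move=> i j Ii Ij [w [Fi Fj]]; apply: tF => //; exists (h w).
  rewrite !measure_bigcup//; [|by move=> k _; exact: mgB|by move=> k _; exact: mfB].
  by apply: eq_eseriesr => k _; exact: PF.
Qed.

Lemma same_distribution_integral (k : \bar R -> \bar R) :
  measurable_fun setT k -> (forall x, 0 <= k x) -> same_distribution P P' f g ->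
  \int[P]_w k (f w) = \int[P']_w k (g w).
Proof.
move=> mk k0 fg.
pose F : {mfun T >-> \bar R} := HB.pack f (isMeasurableFun.Build _ _ _ _ f mf).
pose G : {mfun T' >-> \bar R} := HB.pack g (isMeasurableFun.Build _ _ _ _ g mg).
have := ge0_integral_distribution (P := P) F mk k0.
have := ge0_integral_distribution (P := P') G mk k0.
move=> <- <-; apply: eq_measure_integral => B mB _; exact: fg.
Qed.

End distributions.

Definition stop_loss {R : realType} {disp : measure_display}
    {T : measurableType disp} (P : probability T R) (f : T -> \bar R) (t : R) :=
  (\int[P]_w maxe 0 (t%:E + f w))%E.

Section stop_loss.
Context {R : realType} {disp : measure_display} {T : measurableType disp}
  (P : probability T R) (f : T -> \bar R).
Hypothesis mf : measurable_fun setT f.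
Local Open Scope ereal_scope.

Lemma measurable_maxe0D t : measurable_fun setT (fun w => maxe 0 (t%:E + f w)).
Proof. by apply: measurable_maxe => //; exact: emeasurable_funD. Qed.

Lemma measurable_tail (a : R) : measurable [set w | a%:E < f w].
Proof. by rewrite -[X in measurable X]setTI; exact: emeasurable_fun_o_infty. Qed.

Lemma stop_loss_addE t (s a : R) : (0 <= s)%R ->
  stop_loss P f t + s%:E * P [set w | a%:E < f w] =
  \int[P]_w (maxe 0 (t%:E + f w) + s%:E * (\1_[set w | a%:E < f w]%E w)%:E).
Proof.
move=> s0; have mA := measurable_tail a.
rewrite ge0_integralD//; first last.
- apply: measurable_funeM; exact/measurable_EFinP/measurable_indic.
- by move=> w _; rewrite mule_ge0// lee_fin.
- exact: measurable_maxe0D.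
- by move=> w _; rewrite le_max lexx.
rewrite ge0_integralZl_EFin//; last exact/measurable_EFinP/measurable_indic.
by rewrite integral_indic// setIT.
Qed.

(** Between the levels [a] and [b], the positive part of [f - a] exceeds that of
    [f - b] by at least [b - a] where [f > b], and by at most [b - a], only where
    [f > a]. *)
Lemma stop_loss_tail_le (a b : R) : (a < b)%R ->
  stop_loss P f (- b) + (b - a)%:E * P [set w | b%:E < f w] <= stop_loss P f (- a).
Proof.
move=> ab; rewrite stop_loss_addE ?subr_ge0 ?(ltW ab)// /stop_loss.
apply: ge0_le_integral => //.
- move=> w _; rewrite adde_ge0 ?le_max ?lexx// mule_ge0// lee_fin//.
  by rewrite subr_ge0 ltW.
- apply: emeasurable_funD; first exact: measurable_maxe0D.
  by apply: measurable_funeM; exact/measurable_EFinP/measurable_indic/measurable_tail.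
- exact: measurable_maxe0D.
move=> w _; rewrite indicE; case: (boolP (w \in _)) => /=; last first.
  rewrite mule0 adde0 ge_max !le_max lexx/= => _.
  by rewrite leeD2r ?orbT// lee_fin lerN2 ltW.
move=> /set_mem/=; rewrite mule1; case: (f w) => [r| |]//=.
  rewrite lte_fin => br; rewrite -!EFinD -!EFin_max -EFinD lee_fin.
  by rewrite !max_r; lra.
by move=> _; rewrite !addey// ?max_r ?leey.
Qed.

Lemma stop_loss_tail_ge (a b : R) : (a < b)%R ->
  stop_loss P f (- a) <= stop_loss P f (- b) + (b - a)%:E * P [set w | a%:E < f w].
Proof.
move=> ab; rewrite stop_loss_addE ?subr_ge0 ?(ltW ab)// /stop_loss.
apply: ge0_le_integral => //.
- by move=> w _; rewrite le_max lexx.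
- exact: measurable_maxe0D.
- apply: emeasurable_funD; first exact: measurable_maxe0D.
  by apply: measurable_funeM; exact/measurable_EFinP/measurable_indic/measurable_tail.
move=> w _; rewrite indicE; case: (boolP (w \in _)) => /=; last first.
  move=> wA; rewrite mule0 adde0 ge_max !le_max lexx/= ; apply/orP; left.
  have : f w <= a%:E by rewrite leNgt; apply: contra wA => /mem_set.
  case: (f w) => [r| |]//=; last by rewrite addeNy leNye.
  by rewrite lee_fin -EFinD lee_fin; lra.
move=> /set_mem/=; rewrite mule1; case: (f w) => [r| |]//=.
  rewrite lte_fin => br; rewrite -!EFinD -!EFin_max -EFinD lee_fin.
  by rewrite ge_max; apply/andP; split; case: (leP 0%R (- b + r)%R) => ?; lra.
by move=> _; rewrite !addey// ?max_r ?leey.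
Qed.

Lemma stop_loss_ge0 t : 0 <= stop_loss P f t.
Proof. by apply: integral_ge0 => w _; rewrite le_max lexx. Qed.

Lemma integrable_stop_loss t : P.-integrable setT f -> stop_loss P f t < +oo.
Proof.
move=> if_; have ic : P.-integrable setT (fun w => t%:E + f w).
  by apply: integrableD => //; exact: finite_measure_integrable_cst.
have := integral_funepos_lt_pinfty measurableT ic.
by under eq_integral do rewrite funeposE maxC.
Qed.

(** The transform controls the positive part, the lower bound [g] the negative
    part. *)
Lemma stop_loss_integrable t (g : T -> R) :
  P.-integrable setT (EFin \o g) -> {ae P, forall w, (g w)%:E <= f w} ->
  stop_loss P f t < +oo -> P.-integrable setT f.
Proof.
move=> ig gf ft; apply/integrableP; split=> //.
rewrite /stop_loss in ft; apply: (@le_lt_trans _ _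
    (\int[P]_w (maxe 0 (t%:E + f w)) + \int[P]_w (`|t|%:E + `|(g w)%:E|))).
  rewrite -ge0_integralD//; first last.
  - apply: emeasurable_funD => //.
    by apply: measurableT_comp => //; exact: measurable_int ig.
  - by move=> w _; rewrite adde_ge0// lee_fin.
  - exact: measurable_maxe0D.
  - by move=> w _; rewrite le_max lexx.
  apply: ae_ge0_le_integral => //.
  - exact: measurableT_comp.
  - by move=> w _; rewrite !adde_ge0// ?le_max ?lexx// lee_fin.
  - apply: emeasurable_funD; first exact: measurable_maxe0D.
    apply: emeasurable_funD => //.
    by apply: measurableT_comp => //; exact: measurable_int ig.
  apply: filterS gf => w + _; case: (f w) => [r| |]//=; last first.
    by rewrite addey// max_r ?leey// !addye ?leey.
  rewrite lee_fin => gr; rewrite -EFinD -EFin_max -!EFinD lee_fin.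
  have := ler_norm t; have := ler_norm (- t)%R; rewrite normrN.
  have := ler_norm (g w); have := ler_norm (- g w)%R; rewrite normrN.
  by case: (leP 0%R (t + r)%R); case: (ger0P r) => *; lra.
rewrite lte_add_pinfty//.
apply: integrable_lty => //; apply: integrableD => //.
  exact: finite_measure_integrable_cst.
exact: integrable_abse.
Qed.

End stop_loss.

(** Comparing the two tail estimates gives [P (f > b) <= P' (g > a)] whenever
    [a < b]; letting [b] decrease to [a] compares the tails at the same level.
    Finiteness is what allows the common transform to be cancelled. *)
Lemma stop_loss_same_distribution {R : realType} {disp disp' : measure_display}
    {T : measurableType disp} {T' : measurableType disp'}
    (P : probability T R) (P' : probability T' R)
    (f : T -> \bar R) (g : T' -> \bar R) :
  measurable_fun setT f -> measurable_fun setT g ->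
  (forall t, (stop_loss P f t < +oo)%E) ->
  (forall t, stop_loss P f t = stop_loss P' g t) ->
  same_distribution P P' f g.
Proof.
move=> mf mg f_fin fg.
have tail_le d1 d2 (U : measurableType d1) (U' : measurableType d2)
    (Q : probability U R) (Q' : probability U' R) h h' a :
    measurable_fun setT h -> measurable_fun setT h' ->
    (forall t, (stop_loss Q h t < +oo)%E) ->
    (forall t, stop_loss Q h t = stop_loss Q' h' t) ->
    (Q [set w | a%:E < h w] <= Q' [set w | a%:E < h' w])%E.
  move=> mh mh' h_fin hh'.
  have shift k : (Q [set w | (a + k.+1%:R^-1)%:E < h w] <=
      Q' [set w | a%:E < h' w])%E.
    have ab : a < a + k.+1%:R^-1 by rewrite ltrDl invr_gt0.
    have := le_trans (stop_loss_tail_le Q mh ab) _.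
    rewrite hh' => /(_ _ (stop_loss_tail_ge Q' mh' ab)).
    rewrite -hh' leeD2lE ?ge0_fin_numE ?stop_loss_ge0//.
    by rewrite lee_pmul2l// lte_fin subr_gt0.
  rewrite (_ : mkset _ = \bigcup_k [set w | ((a + k.+1%:R^-1)%:E < h w)%E]).
    have nd : nondecreasing_seq
        (fun k => [set w | ((a + k.+1%:R^-1)%:E < h w)%E]).
      move=> k l kl; apply/subsetPset => w /=; apply: le_lt_trans.
      by rewrite lee_fin lerD2l lef_pV2 ?posrE// ler_nat.
    have mF k := measurable_tail mh (a + k.+1%:R^-1).
    have := nondecreasing_cvg_mu (mu := Q) mF (bigcup_measurable (fun k _ => mF k)) nd.
    move=> cvgF; rewrite -(cvg_lim _ cvgF)//; apply: lime_le.
      by apply/cvg_ex; eexists; exact: cvgF.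
    by apply: nearW => k; exact: shift.
  apply/seteqP; split=> [w /=|w [k _ /=]]; last first.
    by apply: lt_trans; rewrite lte_fin ltrDl invr_gt0.
  case E : (h w) => [r| |]//=; last by exists 0%N => //=; rewrite E ltry.
  rewrite lte_fin => ar.
  have e0 : 0 < r - a by rewrite subr_gt0.
  exists (Num.truncn (r - a)^-1) => //=; rewrite E lte_fin addrC -ltrBrDr.
  by rewrite -[ltRHS]invrK ltf_pV2 ?posrE ?invr_gt0// truncnS_gt.
apply: same_distribution_tails => // a; apply/eqP; rewrite eq_le !tail_le//.
by move=> t; rewrite -fg.
Qed.

(** * Lifted sets and the convexity of selection expectations *)

Section convexity.
Context {R : realType} {n : nat}.
Implicit Types (A : set 'rV[R]_n).

Lemma affine_continuous t (y : 'rV[R]_n) :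
  continuous (fun x : 'rV[R]_n => t *: x + y).
Proof.
move=> x; apply: continuousD; last exact: cst_continuous.
exact: scaler_continuous.
Qed.

(** Closedness passes the property from [A] to its closure in one argument at a
    time. *)
Lemma convex_closure A :
  @convex_set R 'rV[R]_n A -> @convex_set R 'rV[R]_n (closure A).
Proof.
move=> /convex_setP cA; apply/convex_setP.
have half x y t : closure A x -> A y -> 0 <= t <= 1 ->
    closure A (t *: x + (1 - t) *: y).
  move=> + Ay t01; rewrite {1}closureE.
  move=> /(_ ((fun x => t *: x + (1 - t) *: y) @^-1` closure A)); apply; split.
    apply: preimage_closed; last exact: closed_closure.
    by move=> z _; exact: affine_continuous.
  by move=> z Az; apply: subset_closure; exact: cA.
move=> x y t Ax + t01; rewrite {1}closureE.
move=> /(_ ((fun y => (1 - t) *: y + t *: x) @^-1` closure A)).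
rewrite [_ + _ *: y]addrC; apply; split.
  apply: preimage_closed; last exact: closed_closure.
  by move=> z _; exact: affine_continuous.
by move=> z Az /=; rewrite addrC; exact: half.
Qed.

Lemma support_function_closure A v :
  support_function (closure A) v = support_function A v.
Proof.
apply/eqP; rewrite eq_le; apply/andP; split; last first.
  by apply: ereal_sup_le => _ [x Ax <-]; exists x => //; exact: subset_closure.
apply: ge_ereal_sup => _ [x + <-]; rewrite closureE.
move=> /(_ [set x | ((inner x v)%:E <= support_function A v)%E]); apply; split.
  case E : (support_function A v) => [r| |].
  - apply: (preimage_closed (f := inner ^~ v) (D := [set z | z%:E <= r%:E]%E)).
      by move=> z _; exact: inner_continuous.
    by under eq_set do rewrite lee_fin; exact: closed_le.
  - rewrite (_ : mkset _ = setT); first exact: closedT.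
    by apply/seteqP; split=> // y _; exact: leey.
  - rewrite (_ : mkset _ = set0); first exact: closed0.
    by apply/seteqP; split.
by move=> z Az; apply: ereal_sup_ubound; exists z.
Qed.

Lemma convex_hull_inner_le A v M :
  (forall x, A x -> ((inner x v)%:E <= M)%E) ->
  forall x, convex_hull A x -> ((inner x v)%:E <= M)%E.
Proof.
move=> AM x /(_ [set x | ((inner x v)%:E <= M)%E]); apply; split=> //.
apply/convex_setP => y z t /=; case: M {AM} => [r| |]//=; first last.
  by move=> *; exact: leey.
rewrite !lee_fin innerDl !innerZl => yr zr /andP[t0 t1].
by nra.
Qed.

Lemma convex_convex_hull A : @convex_set R 'rV[R]_n (convex_hull A).
Proof.
apply/convex_setP => x y t Ax Ay t01 B AB.
by have /convex_setP := AB.1; apply => //; [exact: Ax|exact: Ay].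
Qed.

End convexity.

Section lift_set.
Context {R : realType} {n : nat}.
Implicit Types (A : set 'rV[R]_n) (u x : 'rV[R]_n).

Lemma inner_row_mx t s u x :
  inner (row_mx (const_mx s) x) (row_mx (const_mx t) u : 'rV[R]_(1 + n)) =
  s * t + inner x u.
Proof.
rewrite /inner big_split_ord/= big_ord1 !row_mxEl !mxE; congr (_ + _).
by apply: eq_bigr => i _; rewrite !row_mxEr.
Qed.

Lemma lift_vectorE (v : 'rV[R]_(1 + n)) :
  v = row_mx (const_mx (v 0 0)) (rsubmx v).
Proof.
rewrite -[LHS]hsubmxK; congr row_mx; apply/rowP => i.
by rewrite !mxE; congr (v _ _); apply/val_inj; rewrite /= ord1.
Qed.

Lemma lift_set0 A : lift_set A 0.
Proof. by move=> B [_]; apply; left. Qed.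

Lemma lift_set_row_mx A x : A x -> lift_set A (row_mx (const_mx 1) x).
Proof. by move=> Ax B [_]; apply; right; exists x. Qed.

Lemma lift_set_inner_le A t u y : lift_set A y ->
  ((inner y (row_mx (const_mx t) u))%:E
    <= maxe 0 (t%:E + support_function A u))%E.
Proof.
apply: convex_hull_inner_le => {}y [->|[x Ax <-]].
  by rewrite inner0l le_max lexx.
rewrite inner_row_mx mul1r EFinD le_max leeD2l ?orbT//.
by apply: ereal_sup_ubound; exists x.
Qed.

End lift_set.

Section vector_expectations.
Context {R : realType} {disp : measure_display} {T : measurableType disp}
  (P : probability T R) {n : nat}.
Implicit Types xi : T -> 'rV[R]_n.

Lemma integrable_inner xi v : integrable_vector P xi ->
  P.-integrable setT (fun w => (inner (xi w) v)%:E).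
Proof.
move=> ixi; under eq_fun do rewrite /inner -sumEFin.
apply: integrable_sum => // i _; under eq_fun do rewrite EFinM.
exact: integrableZr.
Qed.

Lemma inner_vector_expectation xi v : integrable_vector P xi ->
  (inner (vector_expectation P xi) v)%:E = (\int[P]_w (inner (xi w) v)%:E)%E.
Proof.
move=> ixi; rewrite /inner; under [RHS]eq_integral do rewrite -sumEFin.
rewrite integral_sum//; last first.
  by move=> i; under eq_fun do rewrite EFinM; exact: integrableZr.
rewrite -sumEFin; apply: eq_bigr => i _; under eq_integral do rewrite EFinM.
rewrite integralZr// mxE EFinM unlock fineK//.
exact: integrable_fin_num.
Qed.

Lemma integrable_vector_comb xi xi' s t :
  integrable_vector P xi -> integrable_vector P xi' ->
  integrable_vector P (fun w => s *: xi w + t *: xi' w).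
Proof.
move=> ixi ixi' i; under eq_fun do rewrite !mxE EFinD !EFinM.
by apply: integrableD => //; exact: integrableZl.
Qed.

Lemma vector_expectation_comb xi xi' s t :
  integrable_vector P xi -> integrable_vector P xi' ->
  vector_expectation P (fun w => s *: xi w + t *: xi' w) =
  s *: vector_expectation P xi + t *: vector_expectation P xi'.
Proof.
move=> ixi ixi'; apply/rowP => i; rewrite -!inner_delta; apply: EFin_inj.
rewrite inner_vector_expectation; last exact: integrable_vector_comb.
rewrite innerDl !innerZl EFinD !EFinM !inner_vector_expectation//.
under eq_integral do rewrite innerDl !innerZl EFinD !EFinM.
rewrite integralD//; first by rewrite !integralZl//; exact: integrable_inner.
all: by apply: integrableZl => //; exact: integrable_inner.
Qed.

Lemma convex_selection_expectation (Y : T -> set 'rV[R]_n) :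
  (forall w, @convex_set R 'rV[R]_n (Y w)) ->
  @convex_set R 'rV[R]_n (selection_expectation P Y).
Proof.
move=> cY; apply: convex_closure; apply/convex_setP.
move=> _ _ t [xi [ixi Yxi] <-] [xi' [ixi' Yxi'] <-] t01.
exists (fun w => t *: xi w + (1 - t) *: xi' w).
  split; first exact: integrable_vector_comb.
  apply: filterS2 Yxi Yxi' => w Yw Yw'.
  by have /convex_setP := cY w; apply.
exact: vector_expectation_comb.
Qed.

End vector_expectations.

(** * The support function of the lift expectation *)

Section lift_expectation.
Context {R : realType} {disp : measure_display} {T : measurableType disp}
  (P : probability T R) {n : nat} (X : T -> set 'rV[R]_n).

Lemma lift_expectation_closed : closed (lift_expectation P X).
Proof. exact: closed_closure. Qed.

Lemma lift_expectation_convex :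
  @convex_set R 'rV[R]_(1 + n) (lift_expectation P X).
Proof. by apply: convex_selection_expectation => w; exact: convex_convex_hull. Qed.

Lemma lift_expectation_nonempty : lift_expectation P X !=set0.
Proof.
exists (vector_expectation P (fun=> 0 : 'rV[R]_(1 + n))).
apply: subset_closure; exists (fun=> 0) => //; split.
  by move=> i; under eq_fun do rewrite mxE; exact: integrable0.
by apply: aeW => w; exact: lift_set0.
Qed.

Hypothesis bX : random_convex_body P X.

Lemma random_convex_body_support_measurable u :
  measurable_fun setT (fun w => support_function (X w) u).
Proof. by apply: measurable_support_function; case: bX => -[]. Qed.

Lemma selection_inner_le xi t u :
  integrable_selection P (fun w => lift_set (X w)) xi ->
  ((inner (vector_expectation P xi) (row_mx (const_mx t) u))%:E <=
    stop_loss P (fun w => support_function (X w) u) t)%E.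
Proof.
have mh := random_convex_body_support_measurable u.
move=> [ixi Yxi]; rewrite inner_vector_expectation//.
set f := fun w => _ : \bar R.
have if_ : P.-integrable setT f by exact: integrable_inner.
apply: (@le_trans _ _ (\int[P]_w (f^\+ w))%E).
  apply: le_integral => //; first exact: integrable_funepos.
  by move=> w _; rewrite funeposE le_max lexx.
apply: ae_ge0_le_integral => //.
- by apply: measurable_funepos; exact: measurable_int if_.
- by move=> w _; rewrite le_max lexx.
- exact: measurable_maxe0D.
apply: filterS Yxi => w /(lift_set_inner_le t u) yle _.
by rewrite funeposE ge_max yle le_max lexx.
Qed.

(** Only the part of the maximizing selection where it is bounded and has
    [0 < t + h_X(u)] is lifted; elsewhere the origin is selected, as it is the
    maximizer there or keeps the selection integrable. *)
Lemma selection_inner_approx t u r :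
  (r%:E < stop_loss P (fun w => support_function (X w) u) t)%E ->
  exists2 xi, integrable_selection P (fun w => lift_set (X w)) xi &
    r < inner (vector_expectation P xi) (row_mx (const_mx t) u).
Proof.
have mh := random_convex_body_support_measurable u.
have [xi [mxi xiX]] := random_convex_body_maximizer u bX.
pose g w := t + inner (xi w) u.
have mg : measurable_fun setT g.
  apply: measurable_funD => //; apply: measurable_sum => i.
  exact: measurable_funM.
pose b w := \sum_i `|xi w 0 i|.
have mb : measurable_fun setT b.
  by apply: measurable_sum => i; exact: measurableT_comp.
(* [A k] increases to the event where [g] is positive. *)
pose A k := [set w | b w <= k%:R] `&` [set w | 0 < g w].
have mA k : measurable (A k).
  apply: measurableI.
    by rewrite -[X in measurable X]setTI; exact: measurable_fun_ler.
  by rewrite -[X in measurable X]setTI; exact: measurable_fun_ltr.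
have -> : (stop_loss P (fun w => support_function (X w) u) t =
    \int[P]_(w in \bigcup_k A k) (g w)%:E)%E.
  transitivity (\int[P]_w (maxe 0 (g w)%:E))%E.
    apply: ge0_ae_eq_integral => //.
    - exact: measurable_maxe0D.
    - by apply: measurable_maxe => //; exact/measurable_EFinP.
    - by move=> w _; rewrite le_max lexx.
    - by move=> w _; rewrite le_max lexx.
    by apply: filterS xiX => w [_ ->] _; rewrite -EFinD.
  rewrite [RHS]integral_mkcond; apply: eq_integral => w _.
  rewrite patchE; case: ifPn => [/set_mem[k _ [_ /= gw]]|wA].
    by rewrite max_r// lee_fin ltW.
  rewrite max_l// lee_fin leNgt; apply: contra wA => gw.
  apply/mem_set; exists (Num.truncn (b w)).+1 => //; split=> //=.
  by apply/ltW/truncnS_gt.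
have A_nd : nondecreasing_seq A.
  move=> k l kl; apply/subsetPset => w [/= bk gw]; split=> //=.
  by apply: le_trans bk _; rewrite ler_nat.
have gA k w : A k w -> (0 <= (g w)%:E)%E by case=> _ /ltW.
have mgA k : measurable_fun (A k) (EFin \o g).
  by apply: measurable_funTS; exact/measurable_EFinP.
move=> r_lt.
have [k rk] : exists k, (r%:E < \int[P]_(w in A k) (g w)%:E)%E.
  apply: contrapT => /forallNP rk; move: r_lt; apply/negP; rewrite -leNgt.
  have cvgA := ge0_nondecreasing_set_cvg_integral (mu := P) A_nd mA mgA gA.
  rewrite -(cvg_lim _ cvgA)//; apply: lime_le; first by apply/cvg_ex; eexists; exact: cvgA.
  by apply: nearW => k; rewrite leNgt; exact/negP.
pose eta w : 'rV[R]_(1 + n) := \1_(A k) w *: row_mx (const_mx 1) (xi w).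
have ieta : integrable_vector P eta.
  move=> i; apply: measurable_bounded_integrable => //.
  - by apply: fin_num_fun_lty => //; exact: fin_num_measure.
  - rewrite (_ : (fun w => _) = fun w => \1_(A k) w * row_mx (const_mx 1) (xi w) 0 i).
      apply: measurable_funM; first exact: measurable_indic.
      case: (split_ordP i) => j ->; last first.
        by under eq_fun do rewrite row_mxEr; exact: mxi.
      by under eq_fun do rewrite row_mxEl mxE; exact: measurable_cst.
    by apply/funext => w; rewrite mxE.
  - exists (1 + k%:R); split=> [|M kM w _ /=]; first exact: num_real.
    apply: le_trans (ltW kM); rewrite mxE indicE.
    case: (boolP (w \in A k)) => [/set_mem[/= bk _]|_]; last first.
      by rewrite mul0r normr0 addr_ge0.
    rewrite mul1r; case: (split_ordP i) => j ->.
      by rewrite row_mxEl mxE normr1 lerDl.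
    rewrite row_mxEr (le_trans _ (le_trans bk _)) ?lerDr//.
    by rewrite /b (bigD1 j)//= lerDl sumr_ge0.
exists eta.
  split=> //; apply: filterS xiX => w [Xw _].
  rewrite /eta indicE; case: (w \in A k); last by rewrite scale0r; exact: lift_set0.
  by rewrite scale1r; exact: lift_set_row_mx.
rewrite -lte_fin inner_vector_expectation//.
rewrite (_ : \int[P]_w _ = \int[P]_(w in A k) (g w)%:E)%E//.
rewrite [RHS]integral_mkcond; apply: eq_integral => w _.
rewrite patchE /eta innerZl inner_row_mx mul1r indicE.
by case: (w \in A k); rewrite ?mul1r ?mul0r.
Qed.

Lemma support_function_lift_expectation t u :
  (support_function (lift_expectation P X) (row_mx (const_mx t) u) =
    stop_loss P (fun w => support_function (X w) u) t)%E.
Proof.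
rewrite support_function_closure; apply/eqP; rewrite eq_le; apply/andP; split.
  by apply: ge_ereal_sup => _ [_ [xi sxi <-] <-]; exact: selection_inner_le.
set S := support_function _ _; rewrite leNgt; apply/negP => SI.
have Sr r : (r%:E < stop_loss P (fun w => support_function (X w) u) t)%E ->
    (r%:E < S)%E.
  move=> /selection_inner_approx[xi sxi rxi].
  apply: (@lt_le_trans _ _
    (inner (vector_expectation P xi) (row_mx (const_mx t) u))%:E).
    by rewrite lte_fin.
  by apply: ereal_sup_ubound; exists (vector_expectation P xi) => //; exists xi.
(* A real [S] contradicts itself as the threshold; -1 rules out [S = -oo]. *)
move: SI Sr; case: S => [s /[swap] /[apply]||_ /(_ (-1))]; rewrite ?ltxx//.
  by rewrite ltNge leey.
suff /[swap] /[apply] : ((-1)%:E <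
    stop_loss P (fun w => support_function (X w) u) t)%E by [].
apply: (@lt_le_trans _ _ 0%E); first by rewrite lte_fin ltrN10.
exact: stop_loss_ge0.
Qed.

End lift_expectation.

(** * Characterization of equal lift expectations *)

Lemma lift_expectation_sub {R : realType} {disp disp' : measure_display}
    {T : measurableType disp} {T' : measurableType disp'}
    (P : probability T R) (P' : probability T' R) {n : nat}
    (X : T -> set 'rV[R]_n) (X' : T' -> set 'rV[R]_n) :
  (forall v, (support_function (lift_expectation P X) v <=
    support_function (lift_expectation P' X') v)%E) ->
  lift_expectation P X `<=` lift_expectation P' X'.
Proof.
move=> XX' z Xz; apply: mem_closed_convex.
- exact: lift_expectation_closed.
- exact: lift_expectation_convex.
- exact: lift_expectation_nonempty.
by move=> v; apply: le_trans (XX' v); apply: ereal_sup_ubound; exists z.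
Qed.

Lemma integrable_support_function {R : realType} {disp : measure_display}
    {T : measurableType disp} (P : probability T R) {n : nat}
    (X : T -> set 'rV[R]_n) u t :
  random_convex_body P X -> integrable_random_set P X ->
  P.-integrable setT (fun w => support_function (X w) u) <->
  (stop_loss P (fun w => support_function (X w) u) t < +oo)%E.
Proof.
move=> bX [xi [ixi xiX]]; have mX := random_convex_body_support_measurable bX u.
split; first exact: integrable_stop_loss.
apply: (@stop_loss_integrable _ _ _ P _ mX t (fun w => inner (xi w) u)).
  exact: integrable_inner.
by apply: filterS xiX => w Xw; apply: ereal_sup_ubound; exists (xi w).
Qed.

Theorem theorem2p1 (R : realType) (d : nat)
    (disp disp' : measure_display)
    (T : measurableType disp) (T' : measurableType disp')
    (P : probability T R) (P' : probability T' R)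
    (X : T -> set 'rV[R]_d) (X' : T' -> set 'rV[R]_d)
    (bX : random_convex_body P X) (bX' : random_convex_body P' X')
    (iX : integrable_random_set P X) (iX' : integrable_random_set P' X') :
  lift_expectation P X = lift_expectation P' X' <->
  (forall u : 'rV[R]_d,
     P.-integrable setT (fun w => support_function (X w) u) \/
     P'.-integrable setT (fun w => support_function (X' w) u) ->
     same_distribution P P' (fun w => support_function (X w) u)
                            (fun w => support_function (X' w) u)).
Proof.
have mX := random_convex_body_support_measurable bX.
have mX' := random_convex_body_support_measurable bX'.
have iXP u t := integrable_support_function u t bX iX.
have iXP' u t := integrable_support_function u t bX' iX'.
split=> [ZZ' u uXX'|dXX'].
  have eqS t : stop_loss P (fun w => support_function (X w) u) t =
      stop_loss P' (fun w => support_function (X' w) u) t.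
    by rewrite -!support_function_lift_expectation// ZZ'.
  apply: stop_loss_same_distribution => // t; apply/iXP.
  by case: uXX' => // /(iXP' u 0); rewrite -eqS => /iXP.
have eqS v : support_function (lift_expectation P X) v =
    support_function (lift_expectation P' X') v.
  rewrite (lift_vectorE v) !support_function_lift_expectation//.
  set u := rsubmx v; set t := v 0 0.
  have [h|h] := pselect (P.-integrable setT (fun w => support_function (X w) u) \/
     P'.-integrable setT (fun w => support_function (X' w) u)).
    apply: (same_distribution_integral (mX u) (mX' u)
      (k := fun x => maxe 0 (t%:E + x))%E _ _ (dXX' u h)).
    - by apply: measurable_maxe => //; exact: emeasurable_funD.
    - by move=> x; rewrite le_max lexx.
  have infty (s : \bar R) : ~ (s < +oo)%E -> s = +oo%E.
    by move=> /negP; rewrite -leNgt leye_eq => /eqP.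
  transitivity (+oo%E : \bar R); [|symmetry]; apply: infty => fin; apply: h.
    by left; apply/(iXP u t).
  by right; apply/(iXP' u t).
by apply/seteqP; split; apply: lift_expectation_sub => v; rewrite eqS.
Qed.
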